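(* Let $G$ be a graph and let $\{V_1,V_2,V_3\}$ be a partition of $V(G)$. Suppose $G$ has vertices $a_i,b_i$ ($i=1,2,3$, with $a_i\ne b_i$) such that for each $i$: (1) $a_i,b_i\in V_i$; (2) $\{a_i,b_i\}$ separates $V_i$ from $V(G)\setminus V_i$, i.e., every edge of $G$ between $V_i$ and $V(G)\setminus V_i$ has an end in $\{a_i,b_i\}$; (3) the pair $(G[V_i],\{a_i,b_i\})$ is good. Then $\operatorname{mmw}(G)\le 2$.
   Context: All graphs are finite and simple. A tree is subcubic if all its vertices have degree $1$ or $3$; a tree is nontrivial if it has at least one edge. A tree-representation of a graph $G$ is a pair $(T,\{T_x\}_{x\in V(G)})$ where $T$ is a subcubic tree and each $T_x$ is a nontrivial subtree of $T$, such that $T_u$ and $T_v$ share at least one vertex whenever $uv\in E(G)$; its width is the maximum, over edges $e$ of $T$, of the number of subtrees $T_x$ containing $e$. It is known that $\operatorname{mmw}(G)\le k$ iff $G$ has a tree-representation of width at most $k$, where $\operatorname{mmw}(G)$ is the maximum matching width: the minimum over branch-decompositions of $V(G)$ (subcubic tree with leaves bijectively labelled by $V(G)$) of the maximum over tree edges of the size of a maximum matching of $G$ between the two sides of the induced vertex partition. For distinct $a,b\in V(G)$, the pair $(G,\{a,b\})$ is good if $G$ has a tree-representation of width $2$ in which $T_a$ and $T_b$ share an edge of $T$. *)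

(* Defs.v *)
From HB Require Import structures.
From mathcomp Require Import all_boot.
From mathcomp Require Import boolp.

Set Implicit Arguments.
Unset Strict Implicit.
Unset Printing Implicit Defensive.

Record sgraph := SGraph {
  vertex :> finType;
  adj : rel vertex;
  adj_sym : symmetric adj;
  adj_irrefl : irreflexive adj }.

Definition edges (G : sgraph) : {set {set G}} :=
  [set [set p.1; p.2] | p : G * G & adj p.1 p.2].

Definition degree (G : sgraph) (x : G) : nat := #|[set y : G | adj x y]|.

Section Induced.
Variables (G : sgraph) (S : {set G}).

Let induced_adj : rel {x : G | x \in S} := fun x y => adj (val x) (val y).

Lemma induced_adj_sym : symmetric induced_adj.
Proof. by move=> x y; apply: adj_sym. Qed.

Lemma induced_adj_irrefl : irreflexive induced_adj.
Proof. by move=> x; apply: adj_irrefl. Qed.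

Definition induced : sgraph := SGraph induced_adj_sym induced_adj_irrefl.

End Induced.

Definition connected (G : sgraph) : Prop :=
  (0 < #|G|)%N /\ forall x y : G, connect (@adj G) x y.

(* [ucycleb] also holds of lists of length at most 2 (a single edge traversed
   back and forth); the cycles of a simple graph are those of length >= 3. *)
Definition acyclic (G : sgraph) : Prop :=
  forall c : seq G, ucycleb (@adj G) c -> (size c < 3)%N.

Definition is_tree (G : sgraph) : Prop := connected G /\ acyclic G.

Definition subcubic (G : sgraph) : Prop :=
  forall x : G, degree x = 1 \/ degree x = 3.

Definition nontrivial (G : sgraph) : Prop := edges G != set0.

(* A subtree of a tree is an induced subgraph, hence is given by its vertex
   set; it contains the edge [f] of the tree iff [f \subset S]. *)
Definition nontrivial_subtree (T : sgraph) (S : {set T}) : Prop :=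
  is_tree (induced S) /\ nontrivial (induced S).

Record tree_rep (G : sgraph) := TreeRep {
  tr_tree : sgraph;
  tr_sub : G -> {set tr_tree};
  tr_is_tree : is_tree tr_tree;
  tr_subcubic : subcubic tr_tree;
  tr_nontrivial : forall x, nontrivial_subtree (tr_sub x);
  tr_adj : forall u v, adj u v -> tr_sub u :&: tr_sub v != set0 }.

Definition tr_width (G : sgraph) (R : tree_rep G) : nat :=
  \max_(f in edges (tr_tree R)) #|[set x : G | f \subset tr_sub R x]|.

Definition good (G : sgraph) (a b : G) : Prop :=
  exists R : tree_rep G,
    tr_width R = 2 /\
    exists2 f, f \in edges (tr_tree R)
      & (f \subset tr_sub R a) && (f \subset tr_sub R b).

Definition separates (G : sgraph) (S A : {set G}) : Prop :=
  forall u v : G, u \in A -> v \notin A -> adj u v -> (u \in S) || (v \in S).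

Record branch_decomp (G : sgraph) := BranchDecomp {
  bd_tree : sgraph;
  bd_leaf : G -> bd_tree;
  bd_is_tree : is_tree bd_tree;
  bd_subcubic : subcubic bd_tree;
  bd_leaf_inj : injective bd_leaf;
  bd_leaf_onto : [set bd_leaf x | x : G] = [set t | degree t == 1] }.

Definition cut_matching (G : sgraph) (A : {set G}) (M : {set {set G}}) : bool :=
  [&& M \subset edges G, trivIset M &
      [forall f in M, (f :&: A != set0) && (f :&: ~: A != set0)]].

Definition max_cut_matching (G : sgraph) (A : {set G}) : nat :=
  \max_(M : {set {set G}} | cut_matching A M) #|M|.

Definition del_edge (T : sgraph) (s t : T) : rel T :=
  fun x y => adj x y && ([set x; y] != [set s; t]).

(* The vertices of [G] whose leaves lie in the component of [s] in the tree
   minus the edge [st]; the other side of the partition is the complement. *)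
Definition bd_side (G : sgraph) (B : branch_decomp G) (s t : bd_tree B) :
    {set G} :=
  [set x : G | connect (del_edge s t) s (bd_leaf B x)].

Definition bd_width (G : sgraph) (B : branch_decomp G) : nat :=
  \max_(p : bd_tree B * bd_tree B | adj p.1 p.2)
    max_cut_matching (bd_side p.1 p.2).

(* Graphs with at most one vertex have no branch-decomposition (a subcubic tree
   has at least two leaves); they get the value 0. *)
Definition mmw (G : sgraph) : nat :=
  if pselect (exists k, `[< exists B : branch_decomp G, bd_width B = k >])
    is left exk then ex_minn exk else 0.

(* Main.v *)
(** A partition side [A] whose boundary edges all meet a set of two vertices
    carries no matching of size 3, so it suffices to find a binary tree with
    leaves [V(G)] in which every subtree has such a label set. Given a
    representation of [G[V_i]] of width 2, orient every tree edge away from the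
    edge [st] shared by the subtrees of [a_i] and [b_i]. For an oriented edge
    [pq], the vertices whose subtree lies beyond [pq] form a set whose boundary
    is covered by the at most two vertices whose subtrees contain [pq]: since
    [a_i] and [b_i] are not beyond [pq], no edge leaves [V_i]. These sets are
    assembled recursively, adding the vertices of the covers one at a time,
    up to [V_i] itself, and the three trees are then joined; the boundary of
    [V_1 + V_2] is that of [V_3]. *)

Require Import Defs.
From mathcomp Require Import all_boot.
From mathcomp Require Import boolp.

Set Implicit Arguments.
Unset Strict Implicit.
Unset Printing Implicit Defensive.

(** * Cuts with small vertex covers and sets assembled from them *)

Section Covers.
Variable G : sgraph.

Definition covered2 (A : {set G}) : Prop :=
  exists2 C : {set G}, #|C| <= 2 & separates C A.

(** Every edge of the matching crosses the cut and so contains a vertex of the cover. Choosing one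
    for each edge is injective because matching edges are disjoint. *)
Lemma covered2_max_cut_matching (A : {set G}) :
  covered2 A -> max_cut_matching A <= 2.
Proof.
case=> C C2 sepC; apply/bigmax_leqP => M /and3P[/subsetP sME tM /forall_inP cM].
apply: leq_trans C2.
have meetC f : f \in M -> exists x, (x \in f) && (x \in C).
  move=> fM; have /imsetP[[u v] /= uv def_f] := sME f fM.
  rewrite inE /= in uv.
  have /andP[/set0Pn[x /setIP[xf xA]] /set0Pn[y /setIP[yf]]] := cM f fM.
  rewrite inE => yA.
  have xy : adj x y.
    move: xf yf xA yA; rewrite def_f !inE.
    move=> /orP[]/eqP-> /orP[]/eqP->; rewrite ?uv 1?adj_sym ?uv //.
      by move=> ->.
    by move=> ->.
  by have /orP[xC|yC] := sepC x y xA yA xy; [exists x | exists y]; apply/andP.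
pose h (f : {set G}) := [pick x | (x \in f) && (x \in C)].
have hP f : f \in M -> exists2 x, h f = Some x & (x \in f) && (x \in C).
  move=> /meetC[x0 x0P]; rewrite /h; case: pickP => [x xP|/(_ x0)]; first by exists x.
  by rewrite x0P.
have h_inj : {in M &, injective h}.
  move=> f g fM gM; have [x -> /andP[xf _]] := hP f fM.
  have [y -> /andP[yg _]] := hP g gM; case=> exy; rewrite -exy in yg.
  apply/eqP/negPn/negP => nfg.
  by have /trivIsetP/(_ f g fM gM nfg)/disjointFr/(_ xf) := tM; rewrite yg.
rewrite -(card_in_imset h_inj) -(card_imset (mem C) (@Some_inj _)).
apply/subset_leq_card/subsetP => _ /imsetP[f fM ->].
by have [x -> /andP[_ xC]] := hP f fM; apply: imset_f.
Qed.

Lemma separatesC (C A : {set G}) : separates C A -> separates C (~: A).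
Proof.
move=> sepC u v; rewrite !inE negbK orbC => uA vA uv.
by apply: sepC vA uA _; rewrite adj_sym.
Qed.

Lemma covered2C (A : {set G}) : covered2 A -> covered2 (~: A).
Proof. by case=> C C2 /separatesC; exists C. Qed.

Lemma separatesU (C A B : {set G}) :
  separates C A -> B \subset C -> separates C (A :|: B).
Proof.
move=> sepC /subsetP BC u v; rewrite !inE negb_or.
case/orP=> [uA|/BC-> //] /andP[vA _]; exact: sepC.
Qed.

(* Label sets of the rooted binary trees all of whose subtrees have a
   [covered2] label set. *)
Inductive decomposable : {set G} -> Prop :=
| decomposable1 x : decomposable [set x]
| decomposableU A B : decomposable A -> decomposable B -> [disjoint A & B] ->
    covered2 (A :|: B) -> decomposable (A :|: B).

(** The empty set labels no tree, yet it does occur as the set of vertices beyond a tree edge. *)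
Definition decomposable0 A := A = set0 \/ decomposable A.

Lemma decomposable_covered2 A : decomposable A -> covered2 A.
Proof.
case=> // x; exists [set x]; first by rewrite cards1.
by move=> u v ->.
Qed.

Lemma decomposable0U A B : decomposable0 A -> decomposable0 B ->
  [disjoint A & B] -> covered2 (A :|: B) -> decomposable0 (A :|: B).
Proof.
case=> [->|dA]; first by rewrite set0U.
case=> [->|dB]; first by rewrite setU0; right.
by move=> dAB cAB; right; apply: decomposableU.
Qed.

(** Vertices of [B] are attached one at a time as new leaves. Since they lie in [C], the same [C]
    covers the boundary of every intermediate set. *)
Lemma decomposable0_addC (C A B : {set G}) : #|C| <= 2 -> separates C A ->
  B \subset C -> decomposable0 A -> decomposable0 (A :|: B).
Proof.
move=> C2 sepC; have [n] := ubnP #|B|; elim: n B => // n IHn B.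
have [->|[x xB]] := set_0Vmem B; first by rewrite setU0.
rewrite (cardsD1 x) xB ltnS => ltn BC dA.
have BxC : B :\ x \subset C := subset_trans (subD1set B x) BC.
have dABx := IHn _ ltn BxC dA.
(* [B] may meet [A]; a vertex that is already present must not get a second leaf. *)
have [xABx|xABx] := boolP (x \in A :|: B :\ x).
  suff -> : A :|: B = A :|: B :\ x by [].
  apply/setP=> y; move: xABx; rewrite !inE eqxx orbF.
  by case: (y =P x) => [-> ->|] //=.
have -> : A :|: B = (A :|: B :\ x) :|: [set x].
  by rewrite -setUA [_ :|: [set x]]setUC setD1K.
apply: decomposable0U => //; first by right; constructor.
  by rewrite disjoint_sym disjoints1.
exists C => //; apply: separatesU; first exact: separatesU.
by rewrite sub1set (subsetP BC).
Qed.

End Covers.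

(** * The two sides of a tree edge *)

Section TreeSides.
Variable T : sgraph.

(** This is the side of the head [q] of the oriented edge, whereas [bd_side] takes the side of the
    first end. *)
Definition edge_side (p q : T) : {set T} := [set y | connect (del_edge p q) q y].

Lemma del_edge_sym (p q : T) : symmetric (del_edge p q).
Proof. by move=> x y; rewrite /del_edge adj_sym [ [set y; x] ]setUC. Qed.

Lemma del_edgeC (p q : T) : del_edge p q =2 del_edge q p.
Proof. by move=> x y; rewrite /del_edge [ [set p; q] ]setUC. Qed.

Lemma set2_eqP (x y s t : T) :
  reflect (x = s /\ y = t \/ x = t /\ y = s) ([set x; y] == [set s; t]).
Proof.
apply: (iffP eqP) => [e|[[-> ->]|[-> ->]]] //; last by rewrite setUC.
have /set2P xst : x \in [set s; t] by rewrite -e set21.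
have /set2P yst : y \in [set s; t] by rewrite -e set22.
have /set2P sxy : s \in [set x; y] by rewrite e set21.
have /set2P txy : t \in [set x; y] by rewrite e set22.
by case: xst yst sxy txy => [?|?] [?|?] [?|?] [?|?]; subst; auto.
Qed.

Lemma edge_side_end p q : q \in edge_side p q.
Proof. by rewrite inE connect0. Qed.

Lemma edge_side_cross p q u v : u \in edge_side p q -> v \notin edge_side p q ->
  adj u v -> u = q /\ v = p.
Proof.
rewrite !inE => qu qv uv.
have : ~~ del_edge p q u v.
  by apply: contra qv => duv; apply: connect_trans qu (connect1 duv).
rewrite /del_edge uv /= negbK => /set2_eqP[[eu ev]|[] //].
by move: qv; rewrite ev connect0.
Qed.

(** Without such an edge, [Z] would be closed under adjacency within [S] and would contain
    everything reachable from [y], including [z]. *)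
Lemma connected_cross (S Z : {set T}) y z : connected (induced S) ->
  y \in S -> y \in Z -> z \in S -> z \notin Z ->
  exists u v, [/\ u \in S /\ u \in Z, v \in S /\ v \notin Z & adj u v].
Proof.
move=> [_ cS] yS yZ zS zZ; apply: contrapT => noc.
pose a := [pred w : induced S | val w \in Z].
have cl : closed (@adj (induced S)) a.
  apply: intro_closed => [|u v uv]; first exact/sym_connect_sym/adj_sym.
  rewrite !inE => uZ; apply/negPn/negP => vZ; apply: noc.
  by exists (val u), (val v); split=> //; split=> //; apply: valP.
have := closed_connect cl (cS (Sub y yS) (Sub z zS)).
by rewrite !inE !SubK yZ (negPf zZ).
Qed.

(** A connected set with vertices on both sides must use [pq], the only edge between them. *)
Lemma connected_side (S : {set T}) p q y : connected (induced S) ->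
  y \in S -> y \in edge_side p q -> ~~ (S \subset edge_side p q) ->
  (p \in S) && (q \in S).
Proof.
move=> cS yS yZ /subsetPn[z zS zZ].
have [u [v [[uS uZ] [vS vZ] uv]]] := connected_cross cS yS yZ zS zZ.
by have [<- <-] := edge_side_cross uZ vZ uv; rewrite uS vS.
Qed.

Lemma nontrivial_neighbour (S : {set T}) q : nontrivial_subtree S ->
  q \in S -> exists2 r, r \in S & adj q r.
Proof.
move=> [[cS _] /set0Pn[_ /imsetP[[x y] xy _]]] qS; rewrite inE /= in xy.
have {}xy : adj (val x) (val y) := xy.
have [z zS zq] : exists2 z, z \in S & z != q.
  have [exq|nxq] := eqVneq (val x) q; last by exists (val x) => //; apply: valP.
  exists (val y); first exact: valP.
  by apply: contraTneq xy => eyq; rewrite exq eyq adj_irrefl.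
have zq1 : z \notin [set q] by rewrite inE.
have [u [v [[_ /set1P->] [vS _] qv]]] := connected_cross cS qS (set11 q) zS zq1.
by exists v.
Qed.

(** The union of both sides is closed under adjacency: the only edge leaving one side ends in the
    other. *)
Lemma edge_side_total (p q y : T) : connected T ->
  (y \in edge_side p q) || (y \in edge_side q p).
Proof.
case=> _ cT.
pose Z := [pred z | (z \in edge_side p q) || (z \in edge_side q p)].
suff cl : closed (@adj T) Z.
  by have := closed_connect cl (cT q y); rewrite !inE connect0 => <-.
apply: intro_closed => [|u v uv]; first exact/sym_connect_sym/adj_sym.
move=> /orP[] uZ; rewrite inE /=; apply/negPn/negP; rewrite negb_or => /andP[v1 v2].
  by have [_ ev] := edge_side_cross uZ v1 uv; rewrite ev edge_side_end in v2.
by have [_ ev] := edge_side_cross uZ v2 uv; rewrite ev edge_side_end in v1.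
Qed.

Hypothesis T_acyclic : acyclic T.

Lemma edge_side_start p q : adj p q -> p \notin edge_side p q.
Proof.
move=> pq; rewrite inE; apply/negP => /connectP[s0 path0 last0].
move: last0; case/shortenP: path0 => s ps us _ lp.
have pa : path (@adj T) q s by apply: sub_path ps => x y /andP[].
have : ucycleb (@adj T) (q :: s) by rewrite /ucycleb us andbT /= rcons_path pa -lp.
(* Acyclicity leaves paths of at most one step from [q] to [p]: the empty one would make [pq] a
   loop, and the other uses the deleted edge. *)
move/T_acyclic; case: s => [|x [|//]] in ps us lp pa * => _.
  by move: pq; rewrite lp adj_irrefl.
by move: lp ps => /= <-; rewrite /del_edge [ [set q; p] ]setUC eqxx !andbF.
Qed.

Lemma edge_side_disjointC p q : adj p q -> [disjoint edge_side p q & edge_side q p].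
Proof.
move=> pq; apply/pred0P => y /=; apply/negP => /andP[]; rewrite !inE.
rewrite (eq_connect (del_edgeC q p)) => qy py.
have := edge_side_start pq; rewrite inE => /negP[].
by apply: connect_trans qy _; rewrite sym_connect_sym //; apply: del_edge_sym.
Qed.

(** A walk from [r] avoiding [qr] never reaches [q], hence never uses [pq] and stays beyond [pq].
    Removing [q] makes the inclusion strict, as induction on the size of the side requires. *)
Lemma edge_side_step p q r : adj p q -> adj q r -> r != p ->
  edge_side q r \subset edge_side p q :\ q.
Proof.
move=> pq qr rp; apply/subsetP => y ysr.
have qnr := edge_side_start qr.
have yq : y != q by apply: contraTneq ysr => ->.
rewrite in_setD1 yq /=.
have rsq : r \in edge_side p q.
  apply/negPn/negP => nr.
  by have [_ /eqP] := edge_side_cross (edge_side_end p q) nr qr; rewrite (negPf rp).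
have cl : closed (del_edge q r) [pred z | (z \in edge_side q r) && (z \in edge_side p q)].
  apply: intro_closed => [|u v uv]; first exact/sym_connect_sym/del_edge_sym.
  rewrite !inE => /andP[ru qu].
  have rv : connect (del_edge q r) r v by apply: connect_trans ru (connect1 uv).
  rewrite rv /=; apply: connect_trans qu _; apply: connect1.
  move: (uv) => /andP[auv _]; rewrite /del_edge auv /=; apply/negP => /set2_eqP e.
  by move: qnr; rewrite inE; case: e => -[? ?]; subst; rewrite ?rv ?ru.
move: ysr; rewrite inE => /(closed_connect cl).
by rewrite !inE connect0; move: rsq; rewrite inE => -> /esym/andP[].
Qed.

Lemma edge_side_disjoint q r1 r2 : adj q r1 -> adj q r2 -> r1 != r2 ->
  [disjoint edge_side q r1 & edge_side q r2].
Proof.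
move=> q1 q2 r12; apply/pred0P => y /=; apply/negP => /andP[y1 y2].
have s12 : edge_side q r2 \subset edge_side r1 q.
  apply: subset_trans (subD1set _ q).
  by apply: edge_side_step; rewrite ?(adj_sym r1) // eq_sym.
have q1' : adj r1 q by rewrite adj_sym.
have := edge_side_disjointC q1'; move/disjointFr/(_ (subsetP s12 _ y2)).
by rewrite y1.
Qed.

(** The vertex [r] is the first step of a simple path from [q] to [y]; the rest of that path avoids
    [q] and therefore the edge [qr]. *)
Lemma edge_side_branch p q y : adj p q -> y \in edge_side p q -> y != q ->
  exists2 r, adj q r && (r != p) & y \in edge_side q r.
Proof.
move=> pq; rewrite inE => /connectP[s0 path0 last0].
move: last0; case/shortenP: path0 => -[|r s] /=; first by move=> _ _ _ ->; rewrite eqxx.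
move=> /andP[/andP[qr qrpq] prs] /andP[qs us] _ ey _.
exists r; first by rewrite qr /=; apply: contraNneq qrpq => ->; rewrite setUC.
rewrite inE; apply/connectP; exists s => //.
have avoid : {in [pred z | z != q] &, subrel (del_edge p q) (del_edge q r)}.
  move=> u v uq vq /andP[uv _]; rewrite /del_edge uv /=.
  by apply/set2_eqP => -[] [? ?]; subst; rewrite !inE eqxx in uq vq.
apply: (sub_in_path avoid _ prs); apply/allP => z zrs.
by apply: contraNneq qs => <-.
Qed.

End TreeSides.

(** * From a representation of width 2 to a decomposable vertex set *)

Section FromTreeRep.
Variables (G T : sgraph) (W : {set G}) (F : G -> {set T}) (a b : G) (s t : T).

(** The block is kept as a subset [W] of [G], not as an induced graph, because boundaries are taken
    in the whole of [G]. *)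
Definition spanning (p q : T) : {set G} :=
  [set x in W | (p \in F x) && (q \in F x)].

Definition beyond (p q : T) : {set G} := [set x in W | F x \subset edge_side p q].

Hypotheses (T_acyclic : acyclic T) (T_connected : connected T)
  (T_subcubic : subcubic T).
Hypothesis F_subtree : forall x, x \in W -> nontrivial_subtree (F x).
Hypothesis F_adj : forall u v, u \in W -> v \in W -> adj u v ->
  F u :&: F v != set0.
Hypothesis F_width : forall p q, adj p q -> #|spanning p q| <= 2.
Hypotheses (ab : a != b) (st : adj s t).
Hypotheses (a_st : a \in spanning s t) (b_st : b \in spanning s t).
Hypothesis ab_sep : separates [set a; b] W.

Let F_connected x : x \in W -> connected (induced (F x)).
Proof. by case/F_subtree => -[]. Qed.

Let F_nonempty x : x \in W -> exists y, y \in F x.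
Proof. by move=> /F_connected[/card_gt0P[y _] _]; exists (val y); apply: valP. Qed.

Lemma spanningC p q : spanning p q = spanning q p.
Proof. by apply/setP=> x; rewrite !inE [(p \in _) && _]andbC. Qed.

Lemma ab_spanning : spanning s t = [set a; b].
Proof.
apply/esym/eqP; rewrite eqEcard subUset !sub1set a_st b_st /=.
by rewrite cards2 ab F_width.
Qed.

Lemma ab_in u v : u \in W -> v \notin W -> adj u v -> u \in [set a; b].
Proof.
move=> uW vW uv; have /orP[//|] := ab_sep uW vW uv.
rewrite -ab_spanning inE => /andP[vW' _]; by rewrite vW' in vW.
Qed.

(** An edge leaving [W] starts at [a] or [b], which are not beyond [pq]. For a neighbour [v] in [W],
    the subtree of [v] meets that of [u] beyond [pq] without being contained there, so it contains
    [pq]. *)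
Lemma separates_beyond p q : adj p q -> [disjoint [set a; b] & beyond p q] ->
  separates (spanning p q) (beyond p q).
Proof.
move=> pq dab u v uD; have := uD; rewrite inE => /andP[uW uF].
rewrite inE negb_and => vD uv.
have [vW|vW] := boolP (v \in W); last first.
  by have := disjointFr dab (ab_in uW vW uv); rewrite uD.
rewrite vW /= in vD.
have /set0Pn[y /setIP[yu yv]] := F_adj uW vW uv.
have := connected_side (F_connected vW) yv (subsetP uF _ yu) vD.
by rewrite !inE vW => ->; rewrite orbT.
Qed.

Lemma spanning_not_beyond (p q : T) x : adj p q -> p \in F x -> x \notin beyond p q.
Proof.
move=> pq px; rewrite inE negb_and; apply/orP; right.
by apply/subsetPn; exists p => //; apply: edge_side_start.
Qed.

Lemma beyond_step (p q r : T) : adj p q -> adj q r -> r != p ->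
  beyond q r \subset beyond p q.
Proof.
move=> pq qr rp; apply/subsetP => x; rewrite !inE => /andP[-> Fx] /=.
apply: subset_trans Fx (subset_trans (edge_side_step T_acyclic pq qr rp) _).
exact: subD1set.
Qed.

(** If [F x] contains [q], being nontrivial it contains an edge [qr]. Otherwise a vertex of [F x]
    lies in some branch at [q], and [F x] either stays in that branch or contains the edge into
    it. *)
Lemma beyond_cases (p q : T) x : adj p q -> x \in beyond p q ->
  exists2 r, adj q r && (r != p) & (x \in beyond q r) || (x \in spanning q r).
Proof.
move=> pq; rewrite inE => /andP[xW Fx].
have [qx|qx] := boolP (q \in F x).
  have [r rx qr] := nontrivial_neighbour (F_subtree xW) qx.
  exists r; last by rewrite !inE xW qx rx orbT.
  rewrite qr; apply: contraTneq (subsetP Fx _ rx) => ->.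
  exact: edge_side_start.
have [y yx] := F_nonempty xW.
have yq : y != q by apply: contraNneq qx => <-.
have [r qr yr] := edge_side_branch pq (subsetP Fx _ yx) yq.
exists r => //; rewrite !inE xW /=.
have [//|nsub] := boolP (F x \subset edge_side q r).
by rewrite (connected_side (F_connected xW) yx yr nsub).
Qed.

Lemma beyond_disjoint (q r1 r2 : T) : adj q r1 -> adj q r2 -> r1 != r2 ->
  [disjoint beyond q r1 & beyond q r2].
Proof.
move=> q1 q2 r12; apply/pred0P => x /=; apply/negP; rewrite !inE.
move=> /andP[/andP[xW F1] /andP[_ F2]]; have [y yx] := F_nonempty xW.
have := disjointFr (edge_side_disjoint T_acyclic q1 q2 r12) (subsetP F1 _ yx).
by rewrite (subsetP F2 _ yx).
Qed.

Lemma other_neighbours (p q : T) : adj p q ->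
  (forall r, adj q r -> r = p) \/
  exists r1 r2, [/\ adj q r1 && (r1 != p), adj q r2 && (r2 != p), r1 != r2 &
    forall r, adj q r -> r != p -> r = r1 \/ r = r2].
Proof.
move=> pq; have pN : p \in [set y | adj q y] by rewrite inE adj_sym.
have := T_subcubic q; rewrite /degree (cardsD1 p) pN add1n.
case=> /eqP; rewrite eqSS; first rewrite cards_eq0 => /eqP N0.
  left=> r qr; apply/eqP/negPn/negP => rp.
  have : r \in [set y | adj q y] :\ p by rewrite !inE rp.
  by rewrite N0 inE.
move=> /cards2P[r1 [r2 [r12 N]]]; right; exists r1, r2.
have NE r : adj q r && (r != p) = (r \in [set r1; r2]).
  by rewrite -N !inE andbC.
rewrite !NE set21 set22; split=> // r qr rp.
by apply/set2P; rewrite -NE qr.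
Qed.

(** Induction on the size of the side. The sets beyond the two further edges at [q] are each
    enlarged by vertices of their own cover; their union is then covered by [spanning p q]. *)
Lemma decomposable_beyond (p q : T) : adj p q -> [disjoint [set a; b] & beyond p q] ->
  decomposable0 (beyond p q).
Proof.
have [n] := ubnP #|edge_side p q|; elim: n p q => // n IHn p q.
rewrite ltnS => len pq dab.
have covD : covered2 (beyond p q).
  by exists (spanning p q); [apply: F_width | apply: separates_beyond].
case: (other_neighbours pq) => [N0|[r1 [r2 [/andP[q1 r1p] /andP[q2 r2p] r12 Nq]]]].
  (* At a leaf [q] nothing lies beyond [pq], since a nontrivial subtree there would need a second
     neighbour of [q]. *)
  left; apply/setP => x; rewrite [RHS]inE; apply/negP => /(beyond_cases pq).
  by case=> r /andP[/N0->]; rewrite eqxx.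
have sub r : adj q r -> r != p -> beyond q r \subset beyond p q by exact: beyond_step.
have dabr r : adj q r -> r != p -> [disjoint [set a; b] & beyond q r].
  by move=> qr rp; apply: disjointWr dab; apply: sub.
have IH r : adj q r -> r != p -> decomposable0 (beyond q r).
  move=> qr rp; apply: IHn => //; last exact: dabr.
  apply: leq_trans len; apply: proper_card.
  apply: sub_proper_trans (edge_side_step T_acyclic pq qr rp) _.
  by rewrite properD1 ?edge_side_end.
have addC r (B : {set G}) : adj q r -> r != p -> B \subset spanning q r ->
    decomposable0 (beyond q r :|: B).
  move=> qr rp Bsub; apply: (decomposable0_addC (C := spanning q r)) => //.
  - exact: F_width.
  - by apply: separates_beyond => //; apply: dabr.
  - exact: IH.
(* The intersection drops subtrees that also contain [p]; a subtree containing both [qr1] and [qr2]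
   is counted in [B1] only. *)
pose B1 := spanning q r1 :&: beyond p q.
pose B2 := (spanning q r2 :&: beyond p q) :\: spanning q r1.
have eD : beyond p q = (beyond q r1 :|: B1) :|: (beyond q r2 :|: B2).
  have B1D : B1 \subset beyond p q := subsetIr _ _.
  have B2D : B2 \subset beyond p q := subset_trans (subsetDl _ _) (subsetIr _ _).
  apply/eqP; rewrite eqEsubset andbC !subUset B1D B2D (sub r1) // (sub r2) //=.
  apply/subsetP => x xD; have [r /andP[qr rp] xr] := beyond_cases pq xD.
  rewrite /B1 /B2 !in_setU in_setD !in_setI xD !andbT.
  case: (Nq r qr rp) xr => -> /orP[] ->; rewrite ?orbT //.
  by case: (x \in spanning q r1); rewrite ?orbT.
rewrite eD; apply: decomposable0U; last by rewrite -eD.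
- by apply: addC => //; apply: subsetIl.
- by apply: addC => //; apply: subset_trans (subsetDl _ _) (subsetIl _ _).
(* Subtrees of members of [B1] and [B2] contain [q], so these members lie beyond no edge directed
   away from [q]. *)
apply/pred0P => x /=; apply/negP => /andP[].
have nb r : adj q r -> (q \in F x) -> x \in beyond q r = false.
  by move=> qr qx; apply/negbTE/spanning_not_beyond.
have sp r : x \in spanning q r -> q \in F x by rewrite inE => /and3P[].
rewrite /B1 /B2 !in_setU in_setD !in_setI.
case/orP=> [x1|/andP[x1 _]].
  case/orP=> [x2|/and3P[_ /sp qx]]; last by rewrite nb in x1.
  by have := disjointFr (beyond_disjoint q1 q2 r12) x1; rewrite x2.
by rewrite x1 nb // (sp r1).
Qed.

Lemma beyond_disjointC (p q : T) : adj p q -> [disjoint beyond p q & beyond q p].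
Proof.
move=> pq; apply/pred0P => x /=; apply/negP; rewrite !inE.
move=> /andP[/andP[xW F1] /andP[_ F2]]; have [y yx] := F_nonempty xW.
have := disjointFr (edge_side_disjointC T_acyclic pq) (subsetP F1 _ yx).
by rewrite (subsetP F2 _ yx).
Qed.

Lemma decomposable_of_rep : decomposable W.
Proof.
have ts : adj t s by rewrite adj_sym.
have sepW : covered2 W.
  by exists [set a; b]; rewrite // cards2 ab.
have dab (p q : T) : adj p q -> spanning p q = [set a; b] ->
    [disjoint [set a; b] & beyond p q].
  move=> pq <-; apply/pred0P => x /=; apply/negP; rewrite inE => /andP[/and3P[_ px _]].
  by rewrite (negbTE (spanning_not_beyond pq px)).
have st_ab := ab_spanning; have ts_ab : spanning t s = [set a; b] by rewrite spanningC.
have d1 := decomposable_beyond st (dab _ _ st st_ab).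
have d2 := decomposable_beyond ts (dab _ _ ts ts_ab).
have sep1 := separates_beyond st (dab _ _ st st_ab).
have d3 : decomposable0 (beyond s t :|: [set a; b]).
  by apply: (decomposable0_addC (C := spanning s t)); rewrite ?F_width // st_ab.
(* A subtree not containing [st] lies on one side of it, and by the width bound only [a] and [b]
   have subtrees containing [st]. *)
have eW : W = (beyond s t :|: [set a; b]) :|: beyond t s.
  apply/setP => x; rewrite -st_ab !in_setU.
  have [xW|xW] := boolP (x \in W); last by rewrite !inE (negbTE xW).
  have [y yx] := F_nonempty xW.
  rewrite !inE xW /=.
  have Fc := F_connected xW.
  have [yt|yt] := boolP (y \in edge_side s t).
    have [//|n] := boolP (F x \subset edge_side s t).
    by rewrite (connected_side Fc yx yt n).
  have ys : y \in edge_side t s.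
    by have := edge_side_total s t y T_connected; rewrite (negbTE yt).
  have [|n] := boolP (F x \subset edge_side t s); first by rewrite orbT.
  by rewrite andbC (connected_side Fc yx ys n) orbT.
have : decomposable0 W.
  rewrite eW; apply: decomposable0U => //; last by rewrite -eW.
  by rewrite -setI_eq0 setIUl setU_eq0 !setI_eq0 beyond_disjointC // dab.
by case=> // W0; move: a_st; rewrite inE W0 inE.
Qed.

End FromTreeRep.

(** * Edge cuts as certificates of acyclicity *)

Section EdgeCuts.
Variable T : sgraph.

(** For adjacent [s] and [t], such an [S] certifies that [st] is a bridge. Certificates of this kind
    carry over to glued trees more directly than statements about cycles. *)
Definition edge_cut (s t : T) (S : {set T}) : Prop :=
  forall x y, adj x y -> ((x \in S) != (y \in S)) = ([set x; y] == [set s; t]).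

Lemma edge_cut_connect s t S x y : edge_cut s t S ->
  connect (del_edge s t) x y -> (x \in S) = (y \in S).
Proof.
move=> cS; apply: closed_connect => u v /andP[uv nst].
by apply/eqP; rewrite -[_ == _]negbK (cS _ _ uv).
Qed.

Lemma edge_cut_ends s t S : edge_cut s t S -> adj s t -> (s \in S) != (t \in S).
Proof. by move=> cS st; rewrite (cS _ _ st). Qed.

Lemma edge_cut_acyclic :
  (forall s t : T, adj s t -> exists S, edge_cut s t S) -> acyclic T.
Proof.
move=> cuts [|x [|y [|z c]]] //= /andP[/and3P[xy yz pc] /and3P[nx ny _]].
have [S cS] := cuts x y xy; suff yx : connect (del_edge x y) y x.
  by have := edge_cut_ends cS xy; rewrite (edge_cut_connect cS yx) eqxx.
(* The cycle has at least three vertices, so [yz] differs from [xy], and the rest of the cycle from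
   [z] back to [x] avoids [y]. *)
have /negP xz : x != z by apply: contraNneq nx => ->; rewrite !inE eqxx orbT.
apply: (@connect_trans _ _ z).
  apply: connect1; rewrite /del_edge yz /=.
  by apply/set2_eqP => -[] [e1 e2]; [move: yz | case: xz]; rewrite ?e2 // e1 -?e2 adj_irrefl.
apply/connectP; exists (rcons c x); last by rewrite last_rcons.
have avoid : {in [pred w | w != y] &, subrel (@adj T) (del_edge x y)}.
  move=> u v uq vq uv; rewrite /del_edge uv /=.
  by apply/set2_eqP => -[] [? ?]; subst; rewrite !inE eqxx in uq vq.
apply: (sub_in_path avoid _ pc); apply/allP => w.
rewrite -rcons_cons mem_rcons inE => /orP[/eqP->|wc]; rewrite inE.
  by apply: contraNneq nx => ->; rewrite inE eqxx.
by apply: contraNneq ny => <-.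
Qed.

(** Membership in [S] is constant on each component left by deleting [st], and the two components
    exhaust [T]. *)
Lemma edge_cut_side s t S : connected T -> edge_cut s t S -> adj s t ->
  s \in S -> edge_side t s = S.
Proof.
move=> cT cS st sS; have := edge_cut_ends cS st; rewrite sS /= => tS.
apply/eqP; rewrite eqEsubset; apply/andP; split; apply/subsetP => y.
  by rewrite inE (eq_connect (del_edgeC t s)) => /(edge_cut_connect cS) <-.
move=> yS; have /orP[] // := edge_side_total s t y cT.
rewrite inE => /(edge_cut_connect cS); rewrite yS => tS'.
by rewrite tS' in tS.
Qed.

Lemma edge_cutC s t S : edge_cut s t S -> edge_cut s t (~: S).
Proof.
move=> cS x y /cS <-; rewrite !inE.
by case: (x \in S); case: (y \in S).
Qed.

Lemma set2_eqE (x y s t : T) :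
  ([set x; y] == [set s; t]) = (x == s) && (y == t) || (x == t) && (y == s).
Proof.
apply/set2_eqP/orP.
  by case=> [[-> ->]|[-> ->]]; rewrite !eqxx; [left | right].
by case=> /andP[/eqP-> /eqP->]; [left | right].
Qed.

End EdgeCuts.

(** * Joining two trees by an edge between their roots *)

Section Glue.
Variables (T1 T2 : sgraph) (r1 : T1) (r2 : T2).

Definition glue_adj : rel (T1 + T2) := fun x y =>
  match x, y with
  | inl u, inl v => adj u v
  | inr u, inr v => adj u v
  | inl u, inr v | inr v, inl u => (u == r1) && (v == r2)
  end.

Lemma glue_adj_sym : symmetric glue_adj.
Proof. by move=> [x|x] [y|y] //=; apply: adj_sym. Qed.

Lemma glue_adj_irrefl : irreflexive glue_adj.
Proof. by move=> [x|x] /=; apply: adj_irrefl. Qed.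

Definition glue : sgraph := SGraph glue_adj_sym glue_adj_irrefl.

Lemma degree_gluel x : degree (inl x : glue) = degree x + (x == r1).
Proof.
rewrite /degree !cardsE -!sum1_card big_mkcond big_sumType /= -big_mkcond /=.
congr addn; rewrite -big_mkcond /= sum1_card.
case: (x == r1); last exact: eq_card0.
by apply: (@eq_card1 _ r2) => y; rewrite !inE.
Qed.

Lemma degree_gluer x : degree (inr x : glue) = degree x + (x == r2).
Proof.
rewrite /degree !cardsE -!sum1_card big_mkcond big_sumType /= addnC -big_mkcond /=.
congr addn; rewrite -big_mkcond /= sum1_card.
case: (x == r2); last by apply: eq_card0 => y; rewrite !inE /= [LHS]andbF.
by apply: (@eq_card1 _ r1) => y; rewrite !inE ?andbT.
Qed.

Lemma connected_glue : connected T1 -> connected T2 -> connected glue.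
Proof.
move=> [_ c1] [_ c2].
have symg : connect_sym (@adj glue) by apply/sym_connect_sym/adj_sym.
have fromr1 y : connect (@adj glue) (inl r1) y.
  have homo (T : sgraph) (h : T -> glue) (u v : T) :
      (forall u' v', adj u' v' -> adj (h u') (h v')) ->
      connect (@adj T) u v -> connect (@adj glue) (h u) (h v).
    move=> hh /connectP[p pp ->]; elim: p u pp => //= w p IHp u /andP[uw /IHp].
    by apply: connect_trans; apply/connect1/hh.
  case: y => y; first exact: (homo T1 inl).
  apply: connect_trans (homo T2 inr _ _ _ (c2 r2 y)) => //.
  by apply: connect1; rewrite /= !eqxx.
split; first by apply/card_gt0P; exists (inl r1).
by move=> x y; apply: connect_trans (fromr1 y); rewrite symg.
Qed.

(** As [S] avoids the root, the new edge has both ends outside it. *)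
Lemma edge_cut_gluel (s t : T1) (S : {set T1}) : r1 \notin S -> edge_cut s t S ->
  @edge_cut glue (inl s) (inl t) [set inl u | u in S].
Proof.
move=> r1S cS x y; rewrite set2_eqE.
have inlE u : (inl u : glue) \in [set inl u | u in S] = (u \in S).
  by rewrite mem_imset //; apply: inl_inj.
have inrE u : (inr u : glue) \in [set inl u | u in S] = false.
  by apply/negP => /imsetP[].
case: x y => [x|x] [y|y] xy; rewrite ?inlE ?inrE //.
- by rewrite (cS _ _ xy) set2_eqE.
- by case/andP: xy => /eqP-> _; rewrite (negbTE r1S) /= ?andbF.
- by case/andP: xy => /eqP-> _; rewrite (negbTE r1S) /= ?andbF.
Qed.

Lemma edge_cut_gluer (s t : T2) (S : {set T2}) : r2 \notin S -> edge_cut s t S ->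
  @edge_cut glue (inr s) (inr t) [set inr u | u in S].
Proof.
move=> r2S cS x y; rewrite set2_eqE.
have inrE u : (inr u : glue) \in [set inr u | u in S] = (u \in S).
  by rewrite mem_imset //; apply: inr_inj.
have inlE u : (inl u : glue) \in [set inr u | u in S] = false.
  by apply/negP => /imsetP[].
case: x y => [x|x] [y|y] xy; rewrite ?inlE ?inrE //.
- by case/andP: xy => _ /eqP->; rewrite (negbTE r2S) /= ?andbF.
- by case/andP: xy => _ /eqP->; rewrite (negbTE r2S) /= ?andbF.
- by rewrite (cS _ _ xy) set2_eqE.
Qed.

Lemma edge_cut_glue : @edge_cut glue (inl r1) (inr r2) [set inr u | u in [set: T2]].
Proof.
move=> x y; rewrite set2_eqE.
have inrE u : (inr u : glue) \in [set inr u | u in [set: T2]] = true.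
  exact: imset_f.
have inlE u : (inl u : glue) \in [set inr u | u in [set: T2]] = false.
  by apply/negP => /imsetP[].
case: x y => [x|x] [y|y] xy; rewrite ?inlE ?inrE //.
- by rewrite /= ?andbF.
- by case/andP: xy => /eqP-> /eqP->; rewrite !eqxx.
- by case/andP: xy => /eqP-> /eqP->; rewrite !eqxx ?orbT.
- by rewrite /= ?andbF.
Qed.

End Glue.

(** * Building branch-decompositions by gluing rooted trees *)

Section Layout.
Variable G : sgraph.

(** Requiring [r \notin S] directs every cut away from the root, so that gluing at [r] changes
    neither [S] nor its labels. Acyclicity is recovered from the cuts by [edge_cut_acyclic]. *)
Record layout (A : {set G}) (T : sgraph) (r : T) (f : G -> T) : Prop := {
  layout_connected : connected T;
  layout_inj : {in A &, injective f};
  layout_cut : forall s t : T, adj s t -> exists S : {set T},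
    [/\ r \notin S, edge_cut s t S & covered2 [set x in A | f x \in S]] }.

Definition glue_leaf (T1 T2 : sgraph) (r1 : T1) (r2 : T2) (A1 : {set G})
    (f1 : G -> T1) (f2 : G -> T2) : G -> glue r1 r2 :=
  fun x => if x \in A1 then inl (f1 x) else inr (f2 x).

Section GlueLayout.
Variables (T1 T2 : sgraph) (r1 : T1) (r2 : T2) (A1 A2 : {set G}).
Variables (f1 : G -> T1) (f2 : G -> T2).
Hypothesis dA : [disjoint A1 & A2].

Local Notation f := (glue_leaf r1 r2 A1 f1 f2).

Lemma mem_glue_leafl u : (inl u \in f @: (A1 :|: A2)) = (u \in f1 @: A1).
Proof.
apply/imsetP/imsetP => -[x]; rewrite /glue_leaf.
  by rewrite inE; case: ifP => // xA _ [->]; exists x.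
by move=> xA ->; exists x; rewrite ?inE xA.
Qed.

Lemma mem_glue_leafr u : (inr u \in f @: (A1 :|: A2)) = (u \in f2 @: A2).
Proof.
apply/imsetP/imsetP => -[x]; rewrite /glue_leaf.
  by rewrite inE; case: ifP => //= xA xB [->]; exists x.
by move=> xA ->; exists x; rewrite ?inE ?xA ?orbT // (disjointFl dA).
Qed.

(** Old cuts survive unchanged. The joining edge is cut by all of [T2], with label set [A2], which
    is why [A2] has to be covered. *)
Lemma glue_layout : layout A1 r1 f1 -> layout A2 r2 f2 -> covered2 A2 ->
  layout (A1 :|: A2) (inl r1 : glue r1 r2) f.
Proof.
move=> L1 L2 cA2; split.
- exact: connected_glue (layout_connected L1) (layout_connected L2).
- move=> x y; rewrite /glue_leaf !inE.
  case: ifP => xA xB; case: ifP => yA yB // [].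
    exact: (layout_inj L1).
  exact: (layout_inj L2).
have r1N (S : {set T2}) : (inl r1 : glue r1 r2) \notin [set inr u | u in S].
  by apply/negP => /imsetP[].
have leafl (S : {set T1}) : [set x in A1 :|: A2 | f x \in [set inl u | u in S]]
    = [set x in A1 | f1 x \in S].
  apply/setP => x; rewrite !inE /glue_leaf; case: ifP => xA /=.
    by rewrite mem_imset //; apply: inl_inj.
  by apply/negP => /andP[_ /imsetP[]].
have leafr (S : {set T2}) : [set x in A1 :|: A2 | f x \in [set inr u | u in S]]
    = [set x in A2 | f2 x \in S].
  apply/setP => x; rewrite !inE /glue_leaf; case: ifP => xA /=.
    by rewrite (disjointFr dA xA); apply/negP => /imsetP[].
  by rewrite mem_imset //; apply: inr_inj.
have cut12 : exists S : {set glue r1 r2}, [/\ inl r1 \notin S, @edge_cut (glue r1 r2) (inl r1) (inr r2) S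
    & covered2 [set x in A1 :|: A2 | f x \in S]].
  exists [set inr u | u in [set: T2]]; split; rewrite ?r1N //.
    exact: edge_cut_glue.
  by rewrite leafr; suff -> : [set x in A2 | f2 x \in [set: T2]] = A2 by [];
    apply/setP => x; rewrite !inE andbT.
case=> s [] t.
- move=> /(layout_cut L1)[S [rS cS covS]].
  exists [set inl u | u in S]; split; last by rewrite leafl.
    by rewrite mem_imset //; apply: inl_inj.
  exact: edge_cut_gluel.
- by move=> /andP[/eqP-> /eqP->].
- move=> /andP[/eqP-> /eqP->]; have [S [rS cS covS]] := cut12.
  by exists S; split=> // x y xy; rewrite (cS _ _ xy) [ [set inl r1; _] ]setUC.
- move=> /(layout_cut L2)[S [rS cS covS]].
  exists [set inr u | u in S]; split; rewrite ?leafr //.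
  exact: edge_cut_gluer.
Qed.

End GlueLayout.

Definition point_adj : rel unit := fun _ _ => false.
Definition point : sgraph :=
  @SGraph unit point_adj (fun _ _ => erefl) (fun _ => erefl).

Lemma degree_point (x : point) : degree x = 0.
Proof. by apply/eqP; rewrite cards_eq0; apply/eqP/setP => y; rewrite !inE. Qed.

Lemma layout_point (A : {set G}) : #|A| <= 1 ->
  layout A (tt : point) (fun=> tt : point).
Proof.
move=> /card_le1_eqP A1; split=> //.
- by split=> [|[] []]; [rewrite card_unit | apply: connect0].
- by move=> x y xA yA _; apply: A1.
Qed.

(* The root carries a pending edge to its future parent, hence its degree is
   counted with one extra unit. *)
Definition rooted_degree (T : sgraph) (r t : T) := degree t + (t == r).

Definition cubic_layout A (T : sgraph) (r : T) f : Prop := layout A r f /\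
  forall t, (rooted_degree r t = 1 \/ rooted_degree r t = 3) /\
    (rooted_degree r t == 1) = (t \in f @: A).

Lemma decomposable_layout A : decomposable A ->
  exists (T : sgraph) (r : T) (f : G -> T), cubic_layout A r f.
Proof.
elim=> [x|A1 A2 dA1 [T1 [r1 [f1 [L1 D1]]]] dA2 [T2 [r2 [f2 [L2 D2]]]] dA _].
  exists point, tt, (fun=> tt); split; first by apply: layout_point; rewrite cards1.
  case; rewrite /rooted_degree degree_point; split; first by left.
  by symmetry; apply/imsetP; exists x; rewrite ?set11.
(* The new root is a point laid out for the empty set, hence unlabelled. Joining it to [r1] and then
   to [r2] gives degree 2, and 3 with the pending edge. *)
have d0 : [disjoint set0 & A1] by rewrite -setI_eq0 set0I.
have L0 : layout set0 (tt : point) (fun=> tt : point).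
  by apply: layout_point; rewrite cards0.
have L01 := glue_layout d0 L0 L1 (decomposable_covered2 dA1).
have d01 : [disjoint set0 :|: A1 & A2] by rewrite set0U.
have := glue_layout d01 L01 L2 (decomposable_covered2 dA2).
set T := glue _ _; set r := inl _; set f := glue_leaf _ _ _ _ _ => L.
exists T, r, f; split; first by rewrite set0U in L.
rewrite -[A1]set0U => -[[[]|t]|t]; rewrite /rooted_degree.
- rewrite mem_glue_leafl // mem_glue_leafl //.
  rewrite !degree_gluel degree_point; split; first by right.
  by rewrite imset0 inE.
- rewrite mem_glue_leafl // mem_glue_leafr //.
  by rewrite degree_gluel degree_gluer /= !addn0; apply: D1.
- rewrite mem_glue_leafr //.
  by rewrite degree_gluer /= addn0; apply: D2.
Qed.

(** A single edge between the two roots realises both pending edges, so rooted degrees become true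
    degrees. *)
Lemma decomposable_branch_decomp (A1 A2 : {set G}) : decomposable A1 -> decomposable A2 ->
  [disjoint A1 & A2] -> A1 :|: A2 = setT ->
  exists B : branch_decomp G, bd_width B <= 2.
Proof.
move=> dA1 dA2 dA AT.
have [T1 [r1 [f1 [L1 D1]]]] := decomposable_layout dA1.
have [T2 [r2 [f2 [L2 D2]]]] := decomposable_layout dA2.
have := glue_layout dA L1 L2 (decomposable_covered2 dA2).
have := @mem_glue_leafl _ _ r1 r2 A1 A2 f1 f2.
have := @mem_glue_leafr _ _ r1 r2 A1 A2 f1 f2 dA.
set f := glue_leaf _ _ _ _ _; set T := glue _ _; rewrite AT => fr fl L.
have T_tree : is_tree T.
  split; first exact: layout_connected L.
  apply: edge_cut_acyclic => s t /(layout_cut L)[S [_ cS _]]; by exists S.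
have T_deg (t : T) : (degree t = 1 \/ degree t = 3) /\ (degree t == 1) = (t \in f @: setT).
  case: t => t; first by rewrite degree_gluel fl; apply: D1.
  by rewrite degree_gluer fr; apply: D2.
have T_cubic : subcubic T by move=> t; case: (T_deg t).
have f_inj : injective f by move=> x y; apply: (layout_inj L).
have f_onto : [set f x | x : G] = [set t | degree t == 1].
  apply/setP => t; rewrite inE (T_deg t).2; by apply/imsetP/imsetP => -[x _ ->]; exists x; rewrite ?inE.
exists (BranchDecomp T_tree T_cubic f_inj f_onto).
apply/bigmax_leqP => -[s t] /= st; apply: covered2_max_cut_matching.
have [S [_ cS]] := layout_cut L st.
have -> : [set x in setT | f x \in S] = [set x | f x \in S].
  by apply/setP => x; rewrite !inE.
move=> covS.
have -> : @bd_side _ (BranchDecomp T_tree T_cubic f_inj f_onto) s t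
    = [set x | f x \in edge_side t s].
  by apply/setP => x; rewrite !inE (eq_connect (del_edgeC t s)).
(* The cut may contain either end of [st]; when it contains [t], its complement is the side of [s]
   and has the same boundary. *)
have [sS|sS] := boolP (s \in S).
  by rewrite (edge_cut_side T_tree.1 cS st sS).
rewrite (edge_cut_side T_tree.1 (edge_cutC cS) st) ?inE //.
have -> : [set x | f x \in ~: S] = ~: [set x | f x \in S].
  by apply/setP => x; rewrite !inE.
exact: covered2C.
Qed.

(** * From good pairs to the maximum matching width *)

Lemma mmw_le (B : branch_decomp G) k : bd_width B <= k -> mmw G <= k.
Proof.
move=> Bk; rewrite /mmw; case: pselect => // exk.
case: ex_minnP => m _ minm; apply: leq_trans Bk; apply: minm.
by apply/asboolP; exists B.
Qed.

Lemma good_decomposable (W : {set G}) a b (aW : a \in W) (bW : b \in W) :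
  a != b -> separates [set a; b] W ->
  @good (induced W) (Sub a aW) (Sub b bW) -> decomposable W.
Proof.
move=> ab sepW [R [wR [_ /imsetP[[s t] st ->]]]] /=; rewrite !subUset !sub1set.
case/andP=> /andP[sa ta] /andP[sb tb]; rewrite inE /= in st.
(* The subtrees are transported from the induced graph to [G]; the default [set0] outside [W] is
   harmless because [spanning] and [beyond] only collect members of [W]. *)
pose F x := if insub x is Some u then tr_sub R u else set0.
have FE x (xW : x \in W) : F x = tr_sub R (Sub x xW) by rewrite /F insubT.
have [T_conn T_acyc] := tr_is_tree R.
apply: (@decomposable_of_rep G (tr_tree R) W F a b s t) => //.
- exact: tr_subcubic.
- by move=> x xW; rewrite FE; apply: tr_nontrivial.
- by move=> u v uW vW uv; rewrite !FE; apply: tr_adj.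
- move=> p q pq.
  have pqE : [set p; q] \in edges (tr_tree R).
    by apply/imsetP; exists (p, q); rewrite ?inE.
  rewrite -[X in _ <= X]wR; apply: leq_trans (leq_bigmax_cond _ pqE).
  rewrite -(card_imset _ val_inj); apply/subset_leq_card/subsetP => x.
  rewrite inE => /andP[xW]; rewrite FE => pqx; apply/imsetP.
  by exists (Sub x xW); rewrite ?SubK // inE subUset !sub1set.
- by rewrite inE aW FE sa.
- by rewrite inE bW FE sb.
Qed.

End Layout.

Theorem lemma3p10 (G : sgraph) (V : 'I_3 -> {set G}) (a b : 'I_3 -> G)
  (V_inj : injective V)
  (V_part : partition [set V i | i : 'I_3] [set: G])
  (ab_neq : forall i, a i <> b i)
  (aV : forall i, a i \in V i)
  (bV : forall i, b i \in V i)
  (ab_sep : forall i, separates [set a i; b i] (V i))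
  (ab_good : forall i, @good (induced (V i)) (Sub (a i) (aV i)) (Sub (b i) (bV i))) :
  mmw G <= 2.
Proof.
have dV i : decomposable (V i).
  apply: good_decomposable (ab_good i); last exact: ab_sep.
  exact/eqP/ab_neq.
case/and3P: V_part => /eqP cov /trivIsetP triv _.
have disj i j : i != j -> [disjoint V i & V j].
  by move=> ij; apply: triv; rewrite ?imset_f // (inj_eq V_inj).
pose i0 : 'I_3 := inord 0; pose i1 : 'I_3 := inord 1; pose i2 : 'I_3 := inord 2.
have neq m n : m < 3 -> n < 3 -> m != n -> inord m != inord n :> 'I_3.
  by move=> m3 n3; rewrite -val_eqE /= !inordK.
have d01 : [disjoint V i0 & V i1] by apply/disj/neq.
have d012 : [disjoint V i0 :|: V i1 & V i2].
  by rewrite -setI_eq0 setIUl setU_eq0 !setI_eq0 !disj ?neq.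
have VT : (V i0 :|: V i1) :|: V i2 = setT.
  apply/setP => x; rewrite in_setT.
  have : x \in cover [set V i | i : 'I_3] by rewrite cov.
  case/bigcupP=> _ /imsetP[i _ ->] xi; rewrite !inE.
  suff e : [\/ i = i0, i = i1 | i = i2] by case: e => <-; rewrite xi ?orbT.
  by case: i {xi} => -[|[|[|//]]] ?; [apply: Or31 | apply: Or32 | apply: Or33];
    apply: val_inj; rewrite /= inordK.
(* Covers pass to complements, so the cover for the third block also serves the union of the first
   two. *)
have V01 : V i0 :|: V i1 = ~: V i2.
  apply/eqP; rewrite eqEsubset -disjoints_subset d012 /=.
  by rewrite -[~: _]setTI -VT -setDE setDUl setDv setU0 subsetDl.
have d : decomposable (V i0 :|: V i1).
  apply: decomposableU => //; rewrite V01; exact/covered2C/decomposable_covered2.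
have [B] := decomposable_branch_decomp d (dV i2) d012 VT.
exact: mmw_le.
Qed.
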